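(* Let $\Psi_{\mathrm{MAP}}$ be the maximum a posteriori test for the hypothesis $H:\langle\varphi,u^\dagger\rangle\le 0$ against $K:\langle\varphi,u^\dagger\rangle>0$, for $\varphi\in\mathcal X$ and a Gaussian prior $\mathcal N(m_0,C_0)$. For every $y\in\mathcal Y^*$ (algebraic dual of $\mathcal Y$) for which the posterior is defined, it holds that $$\Psi_{\mathrm{MAP}}(y)=\begin{cases}1 & \text{if } \langle y,\Phi_{\mathrm{MAP}}\rangle>\langle m_0,T^*\Phi_{\mathrm{MAP}}-\varphi\rangle_{\mathcal X},\\ 0&\text{otherwise,}\end{cases}$$ where $$\Phi_{\mathrm{MAP}}:=TC_0^{1/2}\left(C_0^{1/2}T^*TC_0^{1/2}+\sigma^2\mathrm{Id}\right)^{-1}C_0^{1/2}\varphi.$$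
   Context: $\mathcal X,\mathcal Y$ are real separable Hilbert spaces, $\mathcal X'$ is identified with $\mathcal X$ by the Riesz map (so $\varphi\in\mathcal X$ and $\langle\varphi,u\rangle=\langle\varphi,u\rangle_{\mathcal X}$), $T:\mathcal X\to\mathcal Y$ is bounded linear with adjoint $T^*$, $\sigma>0$, $m_0\in\mathcal X$, and $C_0$ is a self-adjoint, positive definite ($\langle x,C_0x\rangle>0$ for $x\ne0$), trace class operator on $\mathcal X$. The Bayesian model is $Y=TU+\sigma Z$ with prior $U\sim\Pi=\mathcal N(m_0,C_0)$, independent of the Gaussian white noise $Z$ on $\mathcal Y$ (centered, jointly Gaussian, linear in $g$, $\mathbb E[Z(g)Z(h)]=\langle g,h\rangle_{\mathcal Y}$). A realization $y$ of the data is a linear, not necessarily continuous, functional on $\mathcal Y$, and $\langle y,g\rangle:=y(g)$. The posterior is the Gaussian measure $\Pi(\cdot|Y=y)=\mathcal N(m,C)$ on $\mathcal X$ with $$C=\sigma^2C_0^{1/2}(C_0^{1/2}T^*TC_0^{1/2}+\sigma^2\mathrm{Id})^{-1}C_0^{1/2},$$ $$m=m_0+C_0^{1/2}(C_0^{1/2}T^*TC_0^{1/2}+\sigma^2\mathrm{Id})^{-1}C_0^{1/2}T^*(y-Tm_0),$$ where $C_0^{1/2}T^*y\in\mathcal X$ denotes the Riesz representer of $x\mapsto y(TC_0^{1/2}x)$; the posterior is defined for those $y$ for which this functional is bounded on $\mathcal X$ (which is the case for almost every realization of the data). Put $\mathcal X_H=\{x\in\mathcal X:\langle\varphi,x\rangle\le0\}$,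 $\mathcal X_K=\{x\in\mathcal X:\langle\varphi,x\rangle>0\}$. The maximum a posteriori (MAP) test is $\Psi_{\mathrm{MAP}}(y)=1$ if $\Pi(\mathcal X_K|Y=y)>\Pi(\mathcal X_H|Y=y)$ and $\Psi_{\mathrm{MAP}}(y)=0$ otherwise. *)

(* Defs.v *)
From HB Require Import structures.
From mathcomp Require Import all_boot all_order all_algebra.
From mathcomp Require Import sesquilinear.
From mathcomp Require Import all_classical all_reals all_analysis.

Set Implicit Arguments.
Unset Strict Implicit.
Unset Printing Implicit Defensive.

Import Order.TTheory GRing.Theory Num.Theory.
Import numFieldNormedType.Exports.

Local Open Scope classical_set_scope.
Local Open Scope ring_scope.

HB.mixin Record CompleteNormedModule_isHilbert (R : realType) X
    of CompleteNormedModule R X := {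
  dotp : {dot X for @idfun R} ;
  dotp_norm : forall x : X, dotp x x = `|x| ^+ 2
}.

#[short(type="hilbertType")]
HB.structure Definition Hilbert (R : realType) :=
  {X of CompleteNormedModule R X & CompleteNormedModule_isHilbert R X}.

Definition separable (T : topologicalType) : Prop :=
  exists2 D : set T, countable D & dense D.

Notation borel X := (g_sigma_algebraType (@open X)).

Section operators.
Context {R : realType}.

Definition bounded_linear (V W : normedModType R) (A : V -> W) : Prop :=
  linear A /\ exists M : R, forall x, `|A x| <= M * `|x|.

Definition selfadjoint (X : hilbertType R) (A : X -> X) : Prop :=
  forall x y, dotp (A x) y = dotp x (A y).

Definition positive_op (X : hilbertType R) (A : X -> X) : Prop :=
  [/\ bounded_linear A, selfadjoint A & forall x, 0 <= dotp x (A x)].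

Definition positive_definite (X : hilbertType R) (A : X -> X) : Prop :=
  forall x, x != 0 -> 0 < dotp x (A x).

(* In the next four definitions [xget] selects the unique object with the
   given property whenever one exists, and the zero map (or vector)
   otherwise. Existence is guaranteed when, respectively, [A] is bounded
   linear, [A] is a positive operator, [A] has a bounded inverse, and [f] is a
   bounded linear functional. *)
Definition adjoint (X Y : hilbertType R) (A : X -> Y) : Y -> X :=
  xget (fun=> 0) [set B : Y -> X |
    bounded_linear B /\ forall x y, dotp (A x) y = dotp x (B y)].

Definition sqrt_op (X : hilbertType R) (A : X -> X) : X -> X :=
  xget (fun=> 0) [set S : X -> X |
    positive_op S /\ forall x, S (S x) = A x].

Definition inv_op (X : hilbertType R) (A : X -> X) : X -> X :=
  xget (fun=> 0) [set B : X -> X |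
    [/\ bounded_linear B, cancel A B & cancel B A]].

Definition riesz (X : hilbertType R) (f : X -> R) : X :=
  xget 0 [set r : X | forall x, f x = dotp r x].

Definition orthonormal_basis (X : hilbertType R) (E : set X) : Prop :=
  (forall e f, E e -> E f -> dotp e f = (e == f)%:R) /\
  (forall x, (forall e, E e -> dotp e x = 0) -> x = 0).

(* The trace of |A| = (A^* A)^{1/2} is finite; the value of the sum does not
   depend on the orthonormal basis. *)
Definition trace_class (X : hilbertType R) (A : X -> X) : Prop :=
  bounded_linear A /\
  exists2 E : set X, orthonormal_basis E &
    (\esum_(e in E) (dotp (sqrt_op (adjoint A \o A) e) e)%:E < +oo)%E.

End operators.

Section gaussian.
Context {R : realType}.

(* The normal law on the line with mean [m] and *variance* [v >= 0]. The case
   [v = 0] is the Dirac mass at [m], whereas [normal_prob m 0] is the uniform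
   law on [0, 1]. *)
Definition normal_law (m v : R) : set (measurableTypeR R) -> \bar R :=
  if 0 < v then normal_prob m (Num.sqrt v) else dirac m.

Definition has_normal_law d (Omega : measurableType d)
    (P : set Omega -> \bar R) (f : Omega -> R) (m v : R) : Prop :=
  forall A : set (measurableTypeR R), measurable A ->
    P (f @^-1` A) = normal_law m v A.

(* [mu] is N(m, C): each functional <h, .> is normal under [mu], with mean
   <h, m> and variance <h, C h>. *)
Definition gaussian_measure (X : hilbertType R)
    (mu : set (borel X) -> \bar R) (m : X) (C : X -> X) : Prop :=
  forall h : X,
    has_normal_law mu (dotp h : borel X -> R) (dotp h m) (dotp h (C h)).

Record white_noise d (Omega : measurableType d) (P : probability Omega R)
    (Y : hilbertType R) (Z : Y -> Omega -> R) : Prop := {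
  noise_measurable : forall g, measurable_fun setT (Z g) ;
  noise_linear : forall w, scalar (Z^~ w) ;
  noise_jointly_gaussian : forall n (g : 'I_n -> Y) (c : 'I_n -> R),
    exists m v : R, 0 <= v /\
      has_normal_law P (fun w => \sum_(i < n) c i * Z (g i) w) m v ;
  noise_centered : forall g, ('E_P[Z g] = 0)%E ;
  noise_covariance : forall g h,
    ('E_P[(fun w => Z g w * Z h w)%R] = (dotp g h)%:E)%E
}.

(* The sigma-algebras generated by [U] and by the whole family [Z] are
   independent. *)
Definition independent_of_noise d (Omega : measurableType d)
    (P : probability Omega R) (X Y : hilbertType R)
    (U : Omega -> X) (Z : Y -> Omega -> R) : Prop :=
  forall (A : set (borel X)) (E : set Omega), measurable A ->
    <<s [set F | exists (g : Y) (B : set (measurableTypeR R)),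
                   measurable B /\ F = Z g @^-1` B] >> E ->
    (P (U @^-1` A `&` E) = P (U @^-1` A) * P E)%E.

(* The data [D = T U + sigma Z] is tested against vectors [g] of [Y]. *)
Record bayes_model d (Omega : measurableType d) (P : probability Omega R)
    (X Y : hilbertType R) (T : X -> Y) (sigma : R) (m0 : X) (C0 : X -> X)
    (U : Omega -> X) (Z D : Y -> Omega -> R) : Prop := {
  prior_measurable : measurable_fun setT (U : Omega -> borel X) ;
  prior_gaussian :
    gaussian_measure (fun A : set (borel X) => P (U @^-1` A)) m0 C0 ;
  noise_white : white_noise P Z ;
  prior_noise_independent : independent_of_noise P U Z ;
  data_eq : forall g w, D g w = dotp (T (U w)) g + sigma * Z g w
}.

End gaussian.

Section posterior.
Context {R : realType} {X Y : hilbertType R}.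
Variables (T : X -> Y) (sigma : R) (m0 : X) (C0 : X -> X).

Let S := sqrt_op C0.

(* (C0^{1/2} T^* T C0^{1/2} + sigma^2 Id)^{-1} *)
Definition resolvent : X -> X :=
  inv_op (fun x => S (adjoint T (T (S x))) + sigma ^+ 2 *: x).

(* The posterior is defined at the data [y]. *)
Definition posterior_defined (y : {scalar Y}) : Prop :=
  exists M : R, forall x, `|y (T (S x))| <= M * `|x|.

(* C0^{1/2} T^* w for a functional [w] on [Y]. *)
Definition sqrt_adjoint_dual (w : Y -> R) : X := riesz (fun x => w (T (S x))).

Definition post_cov (x : X) : X := sigma ^+ 2 *: S (resolvent (S x)).

Definition post_mean (y : {scalar Y}) : X :=
  m0 + S (resolvent (sqrt_adjoint_dual (fun g => y g - dotp (T m0) g))).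

Definition is_posterior (Pi : {scalar Y} -> probability (borel X) R) : Prop :=
  forall y, posterior_defined y ->
    gaussian_measure (Pi y) (post_mean y) post_cov.

Definition Phi_MAP (phi : X) : Y := T (S (resolvent (S phi))).

End posterior.

Definition hyp_H {R : realType} {X : hilbertType R} (phi : X)
  : set (borel X) := [set x : X | dotp phi x <= 0].

Definition hyp_K {R : realType} {X : hilbertType R} (phi : X)
  : set (borel X) := [set x : X | 0 < dotp phi x].

Definition Psi_MAP {R : realType} {X Y : hilbertType R}
    (Pi : {scalar Y} -> probability (borel X) R) (phi : X) (y : {scalar Y})
  : nat :=
  if (Pi y (hyp_H phi) < Pi y (hyp_K phi))%E then 1%N else 0%N.

(* Main.v *)
(* Under the posterior the functional <phi, .> is normal (or a Dirac mass) with
   mean <phi, m>, and a normal law gives more mass to ]0, +oo[ than to its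
   complement exactly when its mean is positive, whatever its variance. So the
   test is 1 iff <phi, m> > 0. By self-adjointness of C0^{1/2} and of the
   resolvent, and by the Riesz property defining C0^{1/2} T^* (y - T m0),
   <phi, m> = <phi, m0> + y(Phi) - <T m0, Phi>. The Riesz representation
   theorem is obtained by minimizing |x|^2 - 2 f(x). *)
Require Import Defs.
From mathcomp Require Import all_boot all_order all_algebra.
From mathcomp Require Import sesquilinear.
From mathcomp Require Import all_classical all_reals all_analysis.
From mathcomp Require Import measurable_realfun ring lra.
Set Implicit Arguments.
Unset Strict Implicit.
Unset Printing Implicit Defensive.

Import Order.TTheory GRing.Theory Num.Theory.
Import numFieldNormedType.Exports.
Local Open Scope ring_scope.

(** * Bilinear calculus and the Cauchy-Schwarz inequality *)

Section dot_product.
Context {R : realType} {X : hilbertType R}.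
Implicit Types x y z : X.

Lemma dotpC x y : dotp x y = dotp y x.
Proof. by rewrite hermC expr0 mul1r. Qed.

Lemma dotpDr x y z : dotp x (y + z) = dotp x y + dotp x z.
Proof. exact: linearDr. Qed.

Lemma dotpBr x y z : dotp x (y - z) = dotp x y - dotp x z.
Proof. exact: linearBr. Qed.

Lemma dotpZr a x y : dotp x (a *: y) = a * dotp x y.
Proof. by rewrite linearZr_LR. Qed.

Lemma dotp0r x : dotp x 0 = 0.
Proof. exact: linear0r. Qed.

Lemma dotpDl x y z : dotp (x + y) z = dotp x z + dotp y z.
Proof. by rewrite dotpC dotpDr !(dotpC z). Qed.

Lemma dotpBl x y z : dotp (x - y) z = dotp x z - dotp y z.
Proof. by rewrite dotpC dotpBr !(dotpC z). Qed.

Lemma dotpZl a x y : dotp (a *: x) y = a * dotp x y.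
Proof. by rewrite dotpC dotpZr dotpC. Qed.

Lemma dotp0l x : dotp 0 x = 0.
Proof. by rewrite dotpC dotp0r. Qed.

Lemma dotp_eqP x y : (forall z, dotp x z = dotp y z) -> x = y.
Proof.
move=> xy; apply/eqP; rewrite -subr_eq0 -normr_eq0 -sqrf_eq0 -dotp_norm.
by rewrite dotpBl xy subrr.
Qed.

(* The minimum over [t] of [a + 2 t b + t^2 c >= 0] is [a - b^2 / c]. *)
Lemma discriminant_le (a b c : R) : 0 <= c ->
  (forall t, 0 <= a + 2 * t * b + t ^+ 2 * c) -> b ^+ 2 <= a * c.
Proof.
rewrite le_eqVlt => /predU1P[<-|c0] abc.
  have [->|b0] := eqVneq b 0; first by rewrite expr0n mulr0.
  have := abc (- (a + 1) / (2 * b)).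
  rewrite mulr0 addr0 (_ : 2 * _ * b = - (a + 1)); last by field.
  by rewrite opprD addrA subrr add0r ler0N1.
have := abc (- b / c).
rewrite (_ : _ + _ + _ = (a * c - b ^+ 2) / c); last by field; rewrite gt_eqF.
by rewrite pmulr_lge0 ?invr_gt0// subr_ge0.
Qed.

Lemma dotpD_norm x y : `|x + y| ^+ 2 = `|x| ^+ 2 + 2 * dotp x y + `|y| ^+ 2.
Proof. by rewrite -!dotp_norm !(dotpDl, dotpDr) (dotpC y x); ring. Qed.

Lemma dotp_CauchySchwarz x y : `|dotp x y| <= `|x| * `|y|.
Proof.
rewrite -(@ler_pXn2r _ 2)// ?nnegrE ?mulr_ge0// real_normK ?num_real// exprMn.
apply: discriminant_le => [|t]; first exact: sqr_ge0.
have := sqr_ge0 `|x + t *: y|.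
rewrite dotpD_norm dotpZr normrZ exprMn real_normK ?num_real//.
by rewrite mulrA.
Qed.

(** Written with the midpoint, because a lower bound on the minimized functional will be applied
    there. *)
Lemma parallelogram x y :
  `|x - y| ^+ 2 = 2 * `|x| ^+ 2 + 2 * `|y| ^+ 2 - 4 * `|2^-1 *: (x + y)| ^+ 2.
Proof.
rewrite -!dotp_norm !(dotpBl, dotpBr, dotpDl, dotpDr, dotpZl, dotpZr).
by rewrite (dotpC y x); field.
Qed.

End dot_product.

(** * Riesz representation by a minimizing sequence *)

Section riesz_representation.
Local Open Scope classical_set_scope.
Context {R : realType} {X : hilbertType R}.

(* First-order optimality of [u], quantified: perturb [u] to [u + t x]. *)
Lemma minimizing_residual (f : X -> R) (i e : R) (u : X) : scalar f ->
    (forall x, i <= `|x| ^+ 2 - 2 * f x) -> `|u| ^+ 2 - 2 * f u <= i + e ^+ 2 ->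
    0 <= e ->
  forall x, `|dotp u x - f x| <= e * `|x|.
Proof.
move=> flin ile uie e0 x.
rewrite -(@ler_pXn2r _ 2)// ?nnegrE ?mulr_ge0// real_normK ?num_real// exprMn.
apply: discriminant_le => [|t]; first exact: sqr_ge0.
have := ile (t *: x + u); rewrite flin /= (addrC (t *: x)) dotpD_norm.
rewrite dotpZr normrZ exprMn real_normK ?num_real//.
by move: uie; lra.
Qed.

(** For J x = |x|^2 - 2 f x, the linear terms cancel in the parallelogram law: |u - v|^2 = 2 J u + 2
    J v - 4 J ((u + v) / 2), and the last value of J is at least [i]. *)
Lemma minimizing_dist (f : X -> R) (i a b : R) (u v : X) : scalar f ->
    (forall x, i <= `|x| ^+ 2 - 2 * f x) ->
    `|u| ^+ 2 - 2 * f u <= i + a -> `|v| ^+ 2 - 2 * f v <= i + b ->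
  `|u - v| ^+ 2 <= 2 * (a + b).
Proof.
move=> flin ile uia vib; rewrite parallelogram.
have f0 : f 0 = 0.
  by have := flin (-1) 0 0; rewrite scaler0 addr0 /=; lra.
have := ile (2^-1 *: (u + v)).
have -> : f (2^-1 *: (u + v)) = 2^-1 * (f u + f v).
  have := flin 2^-1 (u + v) 0; rewrite addr0 f0 addr0 => ->.
  by have := flin 1 u v; rewrite !scale1r => ->; rewrite mul1r.
lra.
Qed.

Lemma riesz_representation (f : X -> R) (M : R) : scalar f ->
    (forall x, `|f x| <= M * `|x|) ->
  exists r : X, forall x, f x = dotp r x.
Proof.
move=> flin fM.
pose J x : R := `|x| ^+ 2 - 2 * f x.
pose i := inf (range J).
(* Complete the square in |x|^2 - 2 M |x|. *)
have JM x : - M ^+ 2 <= J x.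
  have := fM x; have := ler_norm (f x); have := sqr_ge0 (`|x| - M).
  by rewrite /J; nra.
have hJ : has_inf (range J).
  split; first by exists (J 0), 0.
  by exists (- M ^+ 2) => _ [x _ <-].
have ile x : i <= J x by apply: ge_inf; [case: hJ|exists x].
(* The excess is a square so that [minimizing_residual] applies with e = 1 / (n + 1). *)
have [u uP] : {u : nat -> X & forall n, J (u n) <= i + n.+1%:R^-1 ^+ 2}.
  apply: (@choice _ _ (fun n v => J v <= i + n.+1%:R^-1 ^+ 2)) => n.
  have /(inf_adherent)/(_ hJ)[_ [v _ <-] /ltW vi] :
    0 < (n.+1%:R^-1 : R) ^+ 2 by rewrite exprn_gt0.
  by exists v.
have dle (m n : nat) : (m <= n)%N -> (n.+1%:R^-1 : R) <= m.+1%:R^-1.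
  by move=> mn; rewrite lef_pV2 ?posrE// ler_nat.
have : cvg (u @ \oo).
  apply/cauchy_cvgP/cauchy_exP => _/posnumP[e].
  have [N _ Ne] := near_infty_natSinv_lt (e%:num / 2)%:pos.
  exists (u N), N => // n /= Nn; rewrite -ball_normE /=.
  have {}Ne := Ne N (leqnn N).
  (* The squared distance is at most 2 (1/(N+1)^2 + 1/(n+1)^2), hence at most (2/(N+1))^2. *)
  apply: (@le_lt_trans _ _ (2 * N.+1%:R^-1)); last first.
    by rewrite mulrC -ltr_pdivlMr.
  rewrite -(@ler_pXn2r _ 2)// ?nnegrE ?mulr_ge0// ?invr_ge0//.
  apply: le_trans (minimizing_dist flin ile (uP N) (uP n)) _.
  have : (n.+1%:R^-1 : R) ^+ 2 <= N.+1%:R^-1 ^+ 2.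
    by rewrite ler_pXn2r ?nnegrE// ?invr_ge0// dle.
  by rewrite exprMn; move: (_ ^+ 2) (_^-1 ^+ 2) => a b; lra.
move=> /cvg_ex[r ur]; exists r => x; apply/eqP; rewrite -subr_eq0 -normr_le0.
apply/ler_addgt0Pr => e e0; rewrite add0r.
(* Two errors, |r - u n| |x| and the residual of [u n] at [x], each get half of [e]; the added 1
   covers x = 0. *)
pose d := e / (2 * (`|x| + 1)).
have x0 : 0 < `|x| + 1 by rewrite ltr_wpDl.
have d0 : 0 < d by rewrite divr_gt0// mulr_gt0.
near \oo => n.
have un : `|r - u n| < d.
  by near: n; move/cvgrPdist_lt: ur; exact.
have nd : n.+1%:R^-1 < d.
  by near: n; exact: (near_infty_natSinv_lt (PosNum d0)).
rewrite (_ : f x - _ = - (dotp (r - u n) x + (dotp (u n) x - f x))); last first.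
  by rewrite dotpBl; ring.
rewrite normrN (le_trans (ler_normD _ _))//.
have h1 := dotp_CauchySchwarz (r - u n) x.
have h2 : `|dotp (u n) x - f x| <= n.+1%:R^-1 * `|x|.
  by apply: minimizing_residual flin ile (uP n) _ _; rewrite invr_ge0.
have -> : e = d * (`|x| + 1) + d * (`|x| + 1) by rewrite /d; field; rewrite gt_eqF.
apply: lerD.
  by rewrite (le_trans h1)// ler_pM// ?ltW// ltrDl.
by rewrite (le_trans h2)// ler_pM// ?invr_ge0// ?ltW// ltrDl.
Unshelve. all: by end_near. Qed.

End riesz_representation.

(** * Existence of the adjoint *)

Section adjoint.
Context {R : realType}.

Lemma bounded_linear_pos (V W : normedModType R) (A : V -> W) :
  bounded_linear A -> exists2 M : R, 0 <= M & forall x, `|A x| <= M * `|x|.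
Proof.
move=> [_ [M AM]]; exists `|M| => // x.
by rewrite (le_trans (AM x))// ler_wpM2r// ler_norm.
Qed.

Lemma adjointP (X Y : hilbertType R) (T : X -> Y) : bounded_linear T ->
  forall x y, dotp (T x) y = dotp x (adjoint T y).
Proof.
move=> bT; have [M M0 TM] := bounded_linear_pos bT; case: bT => Tlin _.
suff [B BP] : exists B : Y -> X,
    bounded_linear B /\ forall x y, dotp (T x) y = dotp x (B y).
  by rewrite /adjoint; case: xgetP => [B' _ []|/(_ B)].
have [B BP] : {B : Y -> X & forall y x, dotp (T x) y = dotp (B y) x}.
  apply: (@choice _ _ (fun y v => forall x, dotp (T x) y = dotp v x)) => y.
  apply: (@riesz_representation _ _ _ (M * `|y|)) => [a u v|x] /=.
    by rewrite Tlin dotpDl dotpZl.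
  by rewrite (le_trans (dotp_CauchySchwarz _ _))// mulrAC ler_wpM2r.
exists B; split; last by move=> x y; rewrite BP dotpC.
split=> [a u v|].
  by apply: dotp_eqP => z; rewrite -BP dotpDl dotpZl -!BP dotpDr dotpZr.
(* Divide |B y|^2 = <T (B y), y> <= M |B y| |y| by |B y|. *)
exists M => y; have [->|By0] := eqVneq (B y) 0.
  by rewrite normr0 mulr_ge0.
rewrite -(@ler_pM2r _ `|B y|) ?normr_gt0// -expr2 -dotp_norm -BP.
rewrite (le_trans (ler_norm _))// (le_trans (dotp_CauchySchwarz _ _))//.
by rewrite mulrAC ler_wpM2r.
Qed.

End adjoint.

(* Neither the existence of the square root nor that of the inverse matters
   here: the zero map returned by [xget] in their absence is also bounded and
   self-adjoint. *)
Section operators.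
Context {R : realType} {X : hilbertType R}.

Lemma sqrt_op_bounded_selfadjoint (A : X -> X) :
  bounded_linear (sqrt_op A) /\ selfadjoint (sqrt_op A).
Proof.
rewrite /sqrt_op; case: xgetP => [S _ [[]]//|_]; split.
  split; first by move=> a u v; rewrite scaler0 addr0.
  by exists 0 => x; rewrite normr0 mul0r.
by move=> x y; rewrite dotp0l dotp0r.
Qed.

Lemma inv_op_selfadjoint (A : X -> X) : selfadjoint A -> selfadjoint (inv_op A).
Proof.
rewrite /inv_op; case: xgetP => [B _ [_ AK BK] sA x y|_ _ x y].
  by rewrite -{1}(BK y) -sA BK.
by rewrite dotp0l dotp0r.
Qed.

Lemma resolvent_selfadjoint (Y : hilbertType R) (T : X -> Y) (sigma : R)
  (C0 : X -> X) : bounded_linear T -> selfadjoint (resolvent T sigma C0).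
Proof.
move=> bT; apply: inv_op_selfadjoint => x y.
have [_ sS] := sqrt_op_bounded_selfadjoint C0.
rewrite dotpDl dotpDr dotpZl dotpZr sS -(sS x); congr (_ + _).
by rewrite dotpC -adjointP// dotpC adjointP.
Qed.

Lemma rieszP (f : X -> R) (M : R) : scalar f ->
  (forall x, `|f x| <= M * `|x|) -> forall x, f x = dotp (riesz f) x.
Proof.
move=> flin fM; rewrite /riesz; case: xgetP => // nex.
by have [r /nex] := riesz_representation flin fM.
Qed.

End operators.

(** * Normal masses of the two half-lines *)

Section normal_half_lines.
Context {R : realType}.
Local Open Scope classical_set_scope.
Local Open Scope ereal_scope.
Local Notation mu := (@lebesgue_measure R).
Implicit Types m s v : R.

(** The reflection x -> -x brings both half-lines to the same domain, where the densities can be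
    compared pointwise. *)
Lemma normal_probN_half m s : s != 0%R ->
  normal_prob m s `]-oo, 0%R] =
  \int[mu]_(x in `[0%R, +oo[) (normal_pdf m s (- x))%:E.
Proof.
move=> s0; rewrite /normal_prob -{1}(@oppr0 R) ge0_integration_by_substitutionNy//.
- by apply: continuous_subspaceT; exact: continuous_normal_pdf.
- by move=> x _; exact: normal_pdf_ge0.
Qed.

(** The exponents compare through (-x - m)^2 - (x - m)^2 = 4 x m. *)
Lemma normal_pdfN_lt m s x : s != 0%R ->
  (normal_pdf m s (- x) < normal_pdf m s x)%R = (0 < x * m)%R.
Proof.
move=> s0; rewrite normal_pdfE// ltr_pM2l ?normal_peak_gt0// ltr_expR.
have s2 : (0 < s ^+ 2 *+ 2)%R by rewrite pmulrn_lgt0// exprn_even_gt0.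
rewrite ltr_pM2r ?invr_gt0// ltrN2 -subr_gt0.
rewrite (_ : _ - _ = 4 * (x * m))%R; last by ring.
by rewrite pmulr_rgt0.
Qed.

Lemma normal_prob_half_lt m s : s != 0%R ->
  (normal_prob m s `]-oo, 0%R] < normal_prob m s `]0%R, +oo[) = (0 < m)%R.
Proof.
move=> s0; rewrite normal_probN_half//.
pose f : measurableTypeR R -> \bar R := fun x => (normal_pdf m s x)%:E.
pose g : measurableTypeR R -> \bar R := fun x => (normal_pdf m s (- x))%:E.
have mf : measurable_fun setT f.
  by apply/measurable_EFinP; exact: measurable_normal_pdf.
have mg : measurable_fun setT g.
  apply/measurable_EFinP.
  by apply: (measurableT_comp (measurable_normal_pdf m s)).
have -> : normal_prob m s `]0%R, +oo[ = \int[mu]_(x in `[0%R, +oo[) f x.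
  by rewrite /normal_prob integral_itv_obnd_cbnd//; exact: measurable_funTS.
have f0 x : 0 <= f x by rewrite lee_fin normal_pdf_ge0.
have g0 x : 0 <= g x by rewrite lee_fin normal_pdf_ge0.
have [m0|m0] := ltP 0%R m; last first.
  apply/negbTE; rewrite -leNgt; apply: ge0_le_integral => //=.
  - exact: measurable_funTS.
  - exact: measurable_funTS.
  - move=> x; rewrite in_itv/= andbT => x0; rewrite lee_fin leNgt.
    by rewrite normal_pdfN_lt// -leNgt mulr_ge0_le0.
have intf : mu.-integrable `[0%R, +oo[ f.
  by apply: integrableS (integrable_normal_pdf m s).
have intg : mu.-integrable `[0%R, +oo[ g.
  apply/integrableP; split; first exact: measurable_funTS.
  under eq_integral do rewrite gee0_abs//.
  rewrite -normal_probN_half//.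
  by rewrite (le_lt_trans (probability_le1 (normal_prob m s) _)) ?ltry.
have fg_gt0 x : (0 < x)%R -> 0 < (f \- g) x.
  by move=> x0; rewrite /= -EFinB lte_fin subr_gt0 normal_pdfN_lt// mulr_gt0.
have fg_ge0 x : `[0%R, +oo[ x -> 0 <= (f \- g) x.
  rewrite /= in_itv/= andbT le_eqVlt => /predU1P[<-|/fg_gt0/ltW//].
  by rewrite /f /g oppr0 subee.
rewrite -sube_gt0 -integralB//= lt0e; apply/andP; split; last exact: integral_ge0.
(* Strictness: a zero integral would make [f] and [g] agree almost everywhere on the half-line, but
   they differ on all of ]0, +oo[, which has infinite measure. *)
apply/eqP => int0.
have : ae_eq mu `[0%R, +oo[ (f \- g) (cst 0).
  apply/ae_eq_integral_abs => //.
    by apply: measurable_funTS; exact: emeasurable_funB.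
  rewrite -[RHS]int0; apply: eq_integral => x; rewrite inE => x0.
  by rewrite gee0_abs// fg_ge0.
case=> N [mN N0 subN].
have : mu `]0%R, +oo[ <= mu N.
  apply: le_measure; rewrite ?inE//= => x /=; rewrite in_itv/= andbT => x0.
  apply: subN => /=; apply/not_implyP; split; first by rewrite in_itv/= ltW.
  by apply/eqP; rewrite gt_eqF// fg_gt0.
by rewrite N0 lebesgue_measure_itv/= ltry.
Qed.

(** In the Dirac case the whole mass sits at [m]; for m = 0 it falls in the closed half-line, in
    agreement with the strict sign condition. *)
Lemma normal_law_half_lt m v :
  (normal_law m v [set x : R | (x <= 0)%R] <
   normal_law m v [set x : R | (0 < x)%R]) = (0 < m)%R.
Proof.
rewrite /normal_law; case: ifPn => [v0|_].
  rewrite -(@normal_prob_half_lt _ (Num.sqrt v)) ?gt_eqF ?sqrtr_gt0//.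
  by congr (normal_prob _ _ _ < normal_prob _ _ _);
    apply/seteqP; split => x /=; rewrite in_itv/= ?andbT.
rewrite !diracE; have [m0|m0] := ltP 0%R m.
- by rewrite memNset ?mem_set ?lte01//= leNgt m0.
- by rewrite mem_set// memNset ?lte_fin ?ltr10//=; apply/negP; rewrite -leNgt.
Qed.

End normal_half_lines.

(** * From the sign of the posterior mean to the threshold on the data *)

Theorem theorem2p3 (R : realType) (X Y : hilbertType R)
    (hX : separable X) (hY : separable Y)
    (T : X -> Y) (hT : bounded_linear T)
    (sigma : R) (hsigma : 0 < sigma)
    (m0 : X) (C0 : X -> X)
    (hC0_sa : selfadjoint C0) (hC0_pos : positive_definite C0)
    (hC0_tr : trace_class C0)
    (d : measure_display) (Omega : measurableType d)
    (P : probability Omega R)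
    (U : Omega -> X) (Z D : Y -> Omega -> R)
    (hmodel : bayes_model P T sigma m0 C0 U Z D)
    (Pi : {scalar Y} -> probability (borel X) R)
    (hPi : is_posterior T sigma m0 C0 Pi)
    (phi : X) (y : {scalar Y}) (hy : posterior_defined T C0 y) :
  Psi_MAP Pi phi y =
    (if dotp m0 (adjoint T (Phi_MAP T sigma C0 phi) - phi)
          < y (Phi_MAP T sigma C0 phi)
     then 1%N else 0%N).
Proof.
have [Slin sS] := sqrt_op_bounded_selfadjoint C0.
have law (A : set (measurableTypeR R)) : measurable A ->
    Pi y (preimage (dotp phi : borel X -> R) A) =
    normal_law (dotp phi (post_mean T sigma m0 C0 y))
               (dotp phi (post_cov T sigma C0 phi)) A.
  exact: hPi hy phi A.
rewrite /Psi_MAP /hyp_H /hyp_K (law [set x | x <= 0]%classic); last first.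
  rewrite (_ : [set x | _]%classic = `]-oo, 0]%classic); first exact: measurable_itv.
  by apply/seteqP; split => x /=; rewrite in_itv.
rewrite (law [set x | 0 < x]%classic); last first.
  rewrite (_ : [set x | _]%classic = `]0, +oo[%classic); first exact: measurable_itv.
  by apply/seteqP; split => x /=; rewrite in_itv/= andbT.
rewrite normal_law_half_lt; congr (if _ then _ else _).
set Phi := Phi_MAP T sigma C0 phi.
have -> : dotp phi (post_mean T sigma m0 C0 y) =
    dotp m0 phi + (y Phi - dotp (T m0) Phi).
  rewrite /post_mean dotpDr (dotpC phi); congr (_ + _).
  (* With both operators moved onto [phi], the representer is paired with a vector that [T] after
     C0^{1/2} sends to [Phi]. *)
  rewrite -sS -(resolvent_selfadjoint _ _ hT) dotpC /sqrt_adjoint_dual.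
  have [M yM] := hy.
  have [[N N0 SN] [K K0 TK]] := (bounded_linear_pos Slin, bounded_linear_pos hT).
  case: Slin hT => [Slin _] [Tlin _].
  (* [M] bounds the data part, by definedness of the posterior; the rest bounds <T m0, T C0^{1/2} x>
     by Cauchy-Schwarz, with [K] for [T] and [N] for C0^{1/2}. *)
  rewrite -(@rieszP _ _ _ (M + `|T m0| * (K * N)))// => [a u v|x] /=.
    by rewrite Slin Tlin linearP dotpDr dotpZr /=; ring.
  rewrite (le_trans (ler_normB _ _))// mulrDl lerD//.
  rewrite (le_trans (dotp_CauchySchwarz _ _))// -!mulrA ler_wpM2l//.
  by rewrite (le_trans (TK _))// ler_wpM2l.
rewrite dotpBr -adjointP//; lra.
Qed.
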